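(* For every integer $d\ge 3$, two firefighters are necessary and sufficient to contain a fire on the infinite square grid $G_{\square}$ in the distance-$d$ firefighter game; that is, $f_d(G_{\square}) = 2$.
   Context: $G_{\square}$ is the infinite square grid: vertex set $\mathbb{Z}\times\mathbb{Z}$, with two vertices adjacent if and only if they differ by exactly $1$ in one coordinate and agree in the other. Distance-$d$ (distance-restricted) firefighter game on a graph $G$ with $k$ firefighters and fire at $u$: on turn $0$, the vertex $u$ starts burning, and then the $k$ firefighters are placed on unburnt vertices (several may occupy the same vertex), protecting the vertices they occupy. On each turn $t+1$ ($t\ge 0$), first the fire spreads to every unburnt, unprotected neighbour of every burning vertex; then each firefighter moves from its current vertex to an unburnt vertex at distance at most $d$ (possibly staying put, and several may occupy the same vertex), where the distance is measured in the subgraph of $G$ induced by the currently unburnt vertices (firefighters may not move through the fire), and protects the vertex it arrives at. Once a vertex is burning or protected it remains so for the rest of the game. The fire is contained if after finitely many turns a point is reached where the fire can no longer spread (no burning vertex has an unburnt, unprotected neighbour). $f_d(G,u)$ is the minimum $k$ for which a fire breaking out at $u$ can be contained; for a vertex-transitive graph $G$ this does not depend on $u$ and is written $f_d(G)$. *)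

(* Defs.v *)
From Stdlib Require Import Arith ZArith Lia.
From Stdlib Require Fin.

Record graph := {
  vertex :> Type;
  adj : vertex -> vertex -> Prop;
  adj_sym : forall x y, adj x y -> adj y x;
  adj_irrefl : forall x, ~ adj x x
}.

Arguments adj {g} _ _.

(* [walk A n x y]: a walk of length [n] in the subgraph induced by [A]. *)
Inductive walk {G : graph} (A : G -> Prop) : nat -> G -> G -> Prop :=
| walk_nil (x : G) : A x -> walk A 0 x x
| walk_cons (n : nat) (x y z : G) :
    A x -> adj x y -> walk A n y z -> walk A (S n) x z.

Definition dist_le {G : graph} (A : G -> Prop) (d : nat) (x y : G) : Prop :=
  exists n : nat, n <= d /\ walk A n x y.

(* The fire spreads deterministically, so a strategy for [k] firefighters is
   the sequence of their positions: [p t i] is the vertex occupied by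
   firefighter [i] at the end of turn [t]. *)
Definition strategy (G : graph) (k : nat) : Type := nat -> Fin.t k -> G.

Definition protected {G : graph} {k : nat} (p : strategy G k)
    (t : nat) (v : G) : Prop :=
  exists (s : nat) (i : Fin.t k), s <= t /\ p s i = v.

(* The spread of turn [t + 1] precedes the moves of that turn, hence is only
   stopped by the vertices protected by the end of turn [t]. *)
Fixpoint burning {G : graph} {k : nat} (u : G) (p : strategy G k)
    (t : nat) (v : G) : Prop :=
  match t with
  | 0 => v = u
  | S t' => burning u p t' v \/
      (~ protected p t' v /\ exists w : G, burning u p t' w /\ adj w v)
  end.

Definition unburnt {G : graph} {k : nat} (u : G) (p : strategy G k)
    (t : nat) (v : G) : Prop := ~ burning u p t v.

Definition legal {G : graph} {k : nat} (d : nat) (u : G)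
    (p : strategy G k) : Prop :=
  (forall i : Fin.t k, unburnt u p 0 (p 0 i)) /\
  (forall (t : nat) (i : Fin.t k),
     unburnt u p (S t) (p (S t) i) /\
     dist_le (unburnt u p (S t)) d (p t i) (p (S t) i)).

Definition contained_at {G : graph} {k : nat} (u : G) (p : strategy G k)
    (t : nat) : Prop :=
  ~ exists w v : G, burning u p t w /\ adj w v /\
      unburnt u p t v /\ ~ protected p t v.

Definition containable (G : graph) (d k : nat) (u : G) : Prop :=
  exists p : strategy G k, legal d u p /\ exists t : nat, contained_at u p t.

(* [f_d(G, u) = k] *)
Definition firefighter_number_at (G : graph) (d : nat) (u : G) (k : nat)
    : Prop :=
  containable G d k u /\ forall j : nat, containable G d j u -> k <= j.

(* [f_d(G) = k]: the common value of [f_d(G, u)] over all vertices [u]. *)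
Definition firefighter_number (G : graph) (d k : nat) : Prop :=
  forall u : G, firefighter_number_at G d u k.

Definition grid_adj (x y : Z * Z) : Prop :=
  (Z.abs (fst x - fst y) = 1 /\ snd x = snd y)%Z \/
  (fst x = fst y /\ Z.abs (snd x - snd y) = 1)%Z.

Lemma grid_adj_sym (x y : Z * Z) : grid_adj x y -> grid_adj y x.
Proof. unfold grid_adj; lia. Qed.

Lemma grid_adj_irrefl (x : Z * Z) : ~ grid_adj x x.
Proof. unfold grid_adj; lia. Qed.

Definition square_grid : graph :=
  {| vertex := (Z * Z)%type;
     adj := grid_adj;
     adj_sym := grid_adj_sym;
     adj_irrefl := grid_adj_irrefl |}.

(* Main.v *)
(** Lower bound: measure levels by [x + y] relative to the origin of the fire.
    A nonempty set of [m] vertices of level [n] has at least [m + 1] neighbours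
    of level [n + 1], while a single firefighter protects at most [n + 1]
    vertices before turn [n + 1].  Hence the number of vertices of level [n]
    that burn at turn [n] plus the number of protected vertices of level at
    most [n] exceeds [n], and the fire reaches every level.

    Upper bound: two firefighters leapfrog one another along an explicit spiral
    of diagonals, which closes up at turn 24 with 97 vertices burnt. *)

Require Import Defs.
From Stdlib Require Import ZArith Lia List Bool.
From Stdlib Require Fin FinFun.
Import ListNotations.

(** * Monotonicity of protection, permanence of containment, decidable membership *)

Lemma protected_le {G : graph} {k : nat} (p : strategy G k) (s t : nat) (v : G) :
  s <= t -> protected p s v -> protected p t v.
Proof.
  intros Hst [r [i [Hr Hv]]]. exists r, i. split; [lia | exact Hv].
Qed.

(** A vertex catching fire later needs a burning neighbour, which by induction already burnt at [t];
    having been unprotected later, the vertex was unprotected at [t], so the pair contradicts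
    containment. *)
Lemma contained_at_unburnt {G : graph} {k : nat} (u : G) (p : strategy G k)
    (t : nat) :
  contained_at u p t ->
  forall (n : nat) (v : G), unburnt u p t v -> unburnt u p (n + t) v.
Proof.
  intros Hc n. induction n as [|n IH]; intros v Hv; [exact Hv |].
  intros [Hb | [Hp [w [Hw Ha]]]]; [exact (IH v Hv Hb) |].
  apply (IH w); [| exact Hw].
  intros Hw'. apply Hc. exists w, v. repeat split; trivial.
  intros Hp'. apply Hp. revert Hp'. apply protected_le. lia.
Qed.

Lemma dist_le_weaken {G : graph} (A : G -> Prop) (d e : nat) (x y : G) :
  d <= e -> dist_le A d x y -> dist_le A e x y.
Proof. intros Hde [n [Hn Hw]]. exists n. split; [lia | exact Hw]. Qed.

(** Kept transparent so that membership tests evaluate under [vm_compute]. *)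
Lemma cell_eq_dec (x y : Z * Z) : {x = y} + {x <> y}.
Proof. decide equality; apply Z.eq_dec. Defined.

Definition memb (x : Z * Z) (l : list (Z * Z)) : bool :=
  if in_dec cell_eq_dec x l then true else false.

Lemma memb_true (x : Z * Z) (l : list (Z * Z)) : memb x l = true <-> In x l.
Proof. unfold memb. destruct (in_dec cell_eq_dec x l); split; easy. Qed.

Lemma memb_false (x : Z * Z) (l : list (Z * Z)) :
  negb (memb x l) = true <-> ~ In x l.
Proof. unfold memb. destruct (in_dec cell_eq_dec x l); split; easy. Qed.

(** * One firefighter does not suffice *)

(** Picks the rightmost cell of the front, whose right neighbour supplies the extra cell on the next
    level. *)
Lemma exists_max_fst (l : list (Z * Z)) :
  l <> [] -> exists w, In w l /\ forall v, In v l -> (fst v <= fst w)%Z.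
Proof.
  induction l as [|a l IH]; intros Hl; [easy |].
  destruct l as [|b l].
  - exists a. split; [now left |]. intros v [<- | []]. lia.
  - destruct IH as [w [Hw Hmax]]; [easy |].
    destruct (Z_le_gt_dec (fst a) (fst w)) as [H | H].
    + exists w. split; [now right |].
      intros v [<- | Hv]; [exact H | exact (Hmax v Hv)].
    + exists a. split; [now left |].
      intros v [<- | Hv]; [lia |]. specialize (Hmax v Hv). lia.
Qed.

Definition level (u v : Z * Z) : Z := (fst v - fst u + (snd v - snd u))%Z.

Lemma burning_level (k : nat) (u : Z * Z) (p : strategy square_grid k) (t : nat) :
  forall v : Z * Z,
    burning (G := square_grid) u p t v -> (level u v <= Z.of_nat t)%Z.
Proof.
  induction t as [|t IH]; intros v; cbn [burning].
  - intros ->. unfold level. lia.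
  - intros [Hb | [_ [w [Hw Ha]]]].
    + specialize (IH v Hb). lia.
    + specialize (IH w Hw). cbn in Ha. unfold grid_adj in Ha.
      unfold level in *. lia.
Qed.

(** [guards n] lists what is protected before the spread of turn [n], hence the index shift. Each
    candidate on the next level either burns and enters the new [L], or is guarded and joins [M];
    the one extra candidate raises the count. *)
Lemma front_count (k : nat) (u : Z * Z) (p : strategy square_grid k)
    (guards : nat -> list (Z * Z)) :
  (forall n, length (guards n) <= n) ->
  (forall n v, In v (guards (S n)) <-> protected p n v) ->
  forall n, exists L M : list (Z * Z),
    NoDup L /\ NoDup M /\
    (forall v, In v L ->
       burning (G := square_grid) u p n v /\ level u v = Z.of_nat n) /\
    (forall v, In v M -> In v (guards n) /\ (level u v <= Z.of_nat n)%Z) /\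
    n < length L + length M.
Proof.
  intros Hlen Hguards n. induction n as [|n IH].
  - exists [u], []. split; [constructor; [easy | constructor] |].
    split; [constructor |]. split; [| split; [easy | cbn; lia]].
    intros v [<- | []]. split; [reflexivity | unfold level; lia].
  - destruct IH as [L [M [NL [NM [HL [HM Hcount]]]]]].
    (* At most [n] guarded cells leave [L] nonempty. *)
    assert (HMn : length M <= n).
    { apply Nat.le_trans with (length (guards n)); [| apply Hlen].
      apply NoDup_incl_length; [exact NM |]. intros v Hv. now apply HM. }
    destruct (exists_max_fst L) as [w [Hw Hmax]].
    { intros ->. cbn in Hcount. lia. }
    pose (up := fun v : Z * Z => (fst v, snd v + 1)%Z).
    pose (C := (fst w + 1, snd w)%Z :: map up L).
    assert (NC : NoDup C).
    (* The extra cell lies strictly to the right of every upward translate. *)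
    { constructor.
      - intros Hin. apply in_map_iff in Hin. destruct Hin as [v [Hv HvL]].
        specialize (Hmax v HvL). unfold up in Hv. injection Hv. lia.
      - apply FinFun.Injective_map_NoDup; [| exact NL].
        intros [a b] [c e]. unfold up. cbn. intros H. injection H.
        intros. f_equal; lia. }
    assert (HC : forall v, In v C ->
              level u v = Z.of_nat (S n) /\
              exists x : Z * Z, burning (G := square_grid) u p n x /\ grid_adj x v).
    { intros v [<- | Hv].
      - destruct (HL w Hw) as [Hb Hl]. split.
        + unfold level in *. cbn [fst snd]. lia.
        + exists w. split; [exact Hb |]. left. cbn. lia.
      - apply in_map_iff in Hv. destruct Hv as [x [<- Hx]].
        destruct (HL x Hx) as [Hb Hl]. split.
        + unfold level, up in *. cbn [fst snd]. lia.
        + exists x. split; [exact Hb |]. right. cbn. lia. }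
    pose (f := fun v => memb v (guards (S n))).
    exists (filter (fun v => negb (f v)) C), (filter f C ++ M).
    split; [now apply NoDup_filter |].
    split; [| split; [| split]].
    (* The candidates have level [S n], the cells of [M] at most [n]. *)
    + apply NoDup_app; [now apply NoDup_filter | exact NM |].
      intros v Hv HvM. apply filter_In in Hv.
      destruct (HC v (proj1 Hv)) as [Hl _]. destruct (HM v HvM). lia.
    + intros v Hv. apply filter_In in Hv. destruct Hv as [HvC Hf].
      destruct (HC v HvC) as [Hl [x [Hx Ha]]]. split; [| exact Hl].
      right. split.
      * apply memb_false in Hf. intros Hp. apply Hf. now apply Hguards.
      * now exists x.
    + intros v Hv. apply in_app_or in Hv. destruct Hv as [Hv | Hv].
      * apply filter_In in Hv. destruct Hv as [HvC Hf].
        split; [now apply memb_true |]. destruct (HC v HvC). lia.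
      * destruct (HM v Hv) as [Hg Hl]. split; [| lia].
        (* The second hypothesis describes [guards] only at successors; [guards 0] is empty by its
           length bound. *)
        destruct n as [|n].
        -- destruct (guards 0) eqn:E; [destruct Hg |].
           specialize (Hlen 0). rewrite E in Hlen. cbn in Hlen. lia.
        -- apply Hguards. apply protected_le with n; [lia |].
           now apply Hguards.
    + rewrite length_app. pose proof (filter_length f C) as HfC.
      assert (HlC : length C = S (length L)) by (cbn; now rewrite length_map).
      lia.
Qed.

Lemma Fin_1_unique (i : Fin.t 1) : i = Fin.F1.
Proof.
  apply (Fin.caseS' i); [reflexivity |].
  intros j. exact (Fin.case0 (fun _ => _) j).
Qed.

(** The front of turn [S t] contains a burning vertex of level [t + 1], too far to burn by turn [t],
    although containment at [t] would freeze the fire. *)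
Lemma not_contained_at (k : nat) (u : Z * Z) (p : strategy square_grid k)
    (t : nat) :
  k < 2 -> ~ contained_at (G := square_grid) u p t.
Proof.
  intros Hk Hc.
  assert (Hguards : exists guards : nat -> list (Z * Z),
            (forall n, length (guards n) <= n) /\
            (forall n v, In v (guards (S n)) <-> protected p n v)).
  { destruct k as [|[|k]]; [| | lia].
    - exists (fun _ => []). split; [cbn; lia |]. intros n v. split; [easy |].
      intros [s [i _]]. exact (Fin.case0 (fun _ => _) i).
    (* The [n] positions taken on turns [0] to [n - 1]. *)
    - exists (fun n => map (fun s => p s Fin.F1) (seq 0 n)). split.
      + intros n. now rewrite length_map, length_seq.
      + intros n v. rewrite in_map_iff. split.
        * intros [s [Hv Hs]]. apply in_seq in Hs. exists s, Fin.F1.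
          split; [lia | exact Hv].
        * intros [s [i [Hs Hv]]]. exists s. split; [| apply in_seq; lia].
          now rewrite (Fin_1_unique i) in Hv. }
  destruct Hguards as [guards [Hlen Hguards]].
  destruct (front_count k u p guards Hlen Hguards (S t))
    as [L [M [_ [NM [HL [HM Hcount]]]]]].
  assert (HMt : length M <= S t).
  { apply Nat.le_trans with (length (guards (S t))); [| apply Hlen].
    apply NoDup_incl_length; [exact NM |]. intros v Hv. now apply HM. }
  destruct L as [|v L]; [cbn in Hcount; lia |].
  destruct (HL v (or_introl eq_refl)) as [Hb Hl].
  apply (contained_at_unburnt (G := square_grid) u p t Hc 1 v); [| exact Hb].
  intros Hb'. apply burning_level in Hb'. lia.
Qed.

(** * A strategy for two firefighters *)

(** Entry [t] gives both positions at turn [t], relative to the origin of the fire. The wall winds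
    clockwise until [(-4, 3)] meets its earlier cell [(-3, 3)]. *)
Definition spiral : list ((Z * Z) * (Z * Z)) :=
  [((0, 1), (1, 0)); ((1, -1), (0, -2)); ((-1, -2), (-2, -1));
   ((-3, -1), (-4, 0)); ((-4, 1), (-3, 2)); ((-3, 3), (-2, 4));
   ((-2, 5), (-1, 6)); ((0, 6), (1, 5)); ((2, 5), (3, 4)); ((4, 4), (5, 3));
   ((6, 3), (7, 2)); ((7, 1), (6, 0)); ((6, -1), (5, -2)); ((5, -3), (4, -4));
   ((4, -5), (3, -6)); ((3, -7), (2, -8)); ((1, -8), (0, -7));
   ((-1, -7), (-2, -6)); ((-3, -6), (-4, -5)); ((-5, -5), (-6, -4));
   ((-7, -4), (-8, -3)); ((-8, -2), (-7, -1)); ((-7, 0), (-6, 1));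
   ((-6, 2), (-5, 3)); ((-6, 2), (-4, 3))]%Z.

(* From turn 24 on, both firefighters stay at the last entry. *)
Definition spiral_pos (t : nat) (i : Fin.t 2) : Z * Z :=
  let q := nth t spiral ((-6, 2), (-4, 3))%Z in
  match i with Fin.F1 => fst q | Fin.FS _ => snd q end.

Definition fins : list (Fin.t 2) := [Fin.F1; Fin.FS Fin.F1].

Lemma in_fins (i : Fin.t 2) : In i fins.
Proof.
  apply (Fin.caseS' i); [now left |].
  intros j. rewrite (Fin_1_unique j). now right; left.
Qed.

(** * Translation to the origin, and the fire as a computable list *)

Definition shift (u v : Z * Z) : Z * Z := (fst u + fst v, snd u + snd v)%Z.

Lemma shift_inj (u v w : Z * Z) : shift u v = shift u w -> v = w.
Proof.
  destruct v, w. unfold shift. cbn. intros H. injection H.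
  intros. f_equal; lia.
Qed.

Lemma shift_surj (u v : Z * Z) : exists w, v = shift u w.
Proof.
  exists (fst v - fst u, snd v - snd u)%Z. destruct v. unfold shift. cbn.
  f_equal; lia.
Qed.

Definition nbrs (v : Z * Z) : list (Z * Z) :=
  [(fst v + 1, snd v); (fst v - 1, snd v);
   (fst v, snd v + 1); (fst v, snd v - 1)]%Z.

Lemma in_nbrs (u v w : Z * Z) :
  In w (nbrs v) <-> grid_adj (shift u v) (shift u w).
Proof.
  destruct v as [a b], w as [c e]. unfold nbrs, shift, grid_adj. cbn. split.
  - intros [H | [H | [H | [H | []]]]]; injection H; lia.
  - intros H.
    assert ((c = a + 1 /\ e = b) \/ (c = a - 1 /\ e = b) \/
            (c = a /\ e = b + 1) \/ (c = a /\ e = b - 1))%Z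
      as [[-> ->] | [[-> ->] | [[-> ->] | [-> ->]]]] by lia; tauto.
Qed.

Definition spiral_strategy (u : Z * Z) : strategy square_grid 2 :=
  fun t i => shift u (spiral_pos t i).

Definition walls (t : nat) : list (Z * Z) :=
  flat_map (fun s => map (spiral_pos s) fins) (seq 0 (S t)).

(** Relative coordinates make [fire t] closed for numeral [t], so one evaluation serves every
    [u]. *)
Fixpoint fire (t : nat) : list (Z * Z) :=
  match t with
  | 0 => [(0, 0)%Z]
  | S t' =>
      let F := fire t' in
      let W := walls t' in
      nodup cell_eq_dec
        (F ++ filter (fun v => negb (memb v W)) (flat_map nbrs F))
  end.

Lemma protected_spiral (u : Z * Z) (t : nat) (v : Z * Z) :
  protected (spiral_strategy u) t (shift u v) <-> In v (walls t).
Proof.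
  unfold walls. rewrite in_flat_map. split.
  - intros [s [i [Hs Hv]]]. exists s. split; [apply in_seq; lia |].
    apply shift_inj in Hv. rewrite <- Hv. apply in_map, in_fins.
  - intros [s [Hs Hv]]. apply in_seq in Hs. apply in_map_iff in Hv.
    destruct Hv as [i [<- _]]. exists s, i. split; [lia | reflexivity].
Qed.

Lemma burning_spiral (u : Z * Z) (t : nat) :
  forall v : Z * Z,
    burning (G := square_grid) u (spiral_strategy u) t (shift u v) <->
    In v (fire t).
Proof.
  induction t as [|t IH]; intros v; cbn [burning fire].
  - cbn. destruct u as [a b], v as [c e]. unfold shift. cbn. split.
    + intros H. injection H. intros. left. f_equal; lia.
    + intros [H | []]. injection H. intros <- <-. f_equal; lia.
  - rewrite nodup_In, in_app_iff, filter_In, in_flat_map, memb_false.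
    rewrite <- (protected_spiral u t v), <- (IH v). apply or_iff_compat_l.
    split.
    + intros [Hp [w [Hw Ha]]]. split; [| exact Hp].
      destruct (shift_surj u w) as [x ->]. exists x.
      split; [now apply IH | now apply (in_nbrs u)].
    + intros [[x [Hx Ha]] Hp]. split; [exact Hp |]. exists (shift u x).
      split; [now apply IH | now apply in_nbrs].
Qed.

(** * Bounded search for walks avoiding the fire, and the finite checks *)

Fixpoint reach (F : list (Z * Z)) (n : nat) (x y : Z * Z) : bool :=
  negb (memb x F) &&
  ((if cell_eq_dec x y then true else false) ||
   match n with
   | 0 => false
   | S m => existsb (fun z => reach F m z y) (nbrs x)
   end).

Lemma reach_dist_le (u : Z * Z) (A : Z * Z -> Prop) (F : list (Z * Z)) :
  (forall v, ~ In v F -> A (shift u v)) ->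
  forall (n : nat) (x y : Z * Z),
    reach F n x y = true ->
    dist_le (G := square_grid) A n (shift u x) (shift u y).
Proof.
  intros HA n. induction n as [|n IH]; intros x y; cbn [reach];
    rewrite andb_true_iff, orb_true_iff, memb_false; intros [Hx H];
    apply HA in Hx.
  - destruct (cell_eq_dec x y) as [<- | _]; [| now destruct H].
    exists 0. split; [lia | exact (walk_nil (G := square_grid) _ _ Hx)].
  - destruct (cell_eq_dec x y) as [<- | _].
    + exists 0. split; [lia | exact (walk_nil (G := square_grid) _ _ Hx)].
    + destruct H as [H | H]; [easy |]. apply existsb_exists in H.
      destruct H as [z [Hz H]]. destruct (IH z y H) as [m [Hm Hw]].
      exists (S m). split; [lia |].
      apply walk_cons with (shift u z : square_grid); trivial.
      now apply in_nbrs.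
Qed.

(** Walks must avoid [fire (S t)], since the fire spreads before the firefighters move. *)
Definition moves_ok (t : nat) : bool :=
  let F := fire (S t) in
  forallb (fun i =>
    negb (memb (spiral_pos (S t) i) F) &&
    reach F 3 (spiral_pos t i) (spiral_pos (S t) i)) fins.

Lemma all_moves_ok : forallb moves_ok (seq 0 24) = true.
Proof. vm_compute. reflexivity. Qed.

Lemma fire_enclosed :
  (let F := fire 24 in
   let W := walls 24 in
   forallb (fun v => memb v F || memb v W) (flat_map nbrs F)) = true.
Proof. vm_compute. reflexivity. Qed.

Lemma spiral_contained_at (u : Z * Z) :
  contained_at (G := square_grid) u (spiral_strategy u) 24.
Proof.
  intros [w [v [Hw [Ha [Hu Hp]]]]].
  destruct (shift_surj u w) as [x ->], (shift_surj u v) as [y ->].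
  apply burning_spiral in Hw.
  pose proof fire_enclosed as H. cbv zeta in H. rewrite forallb_forall in H.
  specialize (H y). rewrite in_flat_map, orb_true_iff, !memb_true in H.
  destruct H as [H | H].
  - exists x. split; [exact Hw | exact (proj2 (in_nbrs u x y) Ha)].
  - apply Hu, burning_spiral, H.
  - apply Hp, protected_spiral, H.
Qed.

Lemma spiral_legal (u : Z * Z) :
  legal (G := square_grid) 3 u (spiral_strategy u).
Proof.
  assert (Hunb : forall t v, ~ In v (fire t) ->
            unburnt (G := square_grid) u (spiral_strategy u) t (shift u v)).
  { intros t v Hv Hb. apply Hv. now apply (burning_spiral u). }
  assert (Hmove : forall t i, t < 24 ->
            ~ In (spiral_pos (S t) i) (fire (S t)) /\
            reach (fire (S t)) 3 (spiral_pos t i) (spiral_pos (S t) i) = true).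
  { intros t i Ht. pose proof all_moves_ok as H.
    rewrite forallb_forall in H. specialize (H t).
    unfold moves_ok in H. cbv zeta in H. rewrite forallb_forall in H.
    rewrite <- memb_false. apply andb_true_iff. apply H; [| apply in_fins].
    apply in_seq. lia. }
  split.
  - intros i. apply Hunb. destruct (in_fins i) as [<- | [<- | []]];
      apply memb_false; vm_compute; reflexivity.
  - intros t i. destruct (Nat.lt_ge_cases t 24) as [Ht | Ht].
    + destruct (Hmove t i Ht) as [H1 H2]. split; [now apply Hunb |].
      exact (reach_dist_le u _ _ (Hunb (S t)) 3 _ _ H2).
    (* Past the end of the list, the default of [nth] equals the last entry. *)
    + assert (Hstay : forall s, 24 <= s ->
                spiral_strategy u s i = spiral_strategy u 24 i).
      { intros s Hs. unfold spiral_strategy, spiral_pos.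
        destruct (Nat.eq_dec s 24) as [-> | Hne]; [reflexivity |].
        now rewrite (nth_overflow spiral (n := s)) by (cbn; lia). }
      assert (H : unburnt (G := square_grid) u (spiral_strategy u) (S t)
                    (spiral_strategy u 24 i)).
      (* Containment at turn 24 carries the unburnt final positions to all later turns; the last
         checked move, from turn 23, shows them unburnt at 24. *)
      { replace (S t) with (S t - 24 + 24) by lia.
        apply contained_at_unburnt; [apply spiral_contained_at |].
        apply Hunb. apply (Hmove 23 i). lia. }
      rewrite (Hstay t Ht), (Hstay (S t)) by lia. split; [exact H |].
      exists 0. split; [lia | exact (walk_nil (G := square_grid) _ _ H)].
Qed.

Theorem lemma3p1 (d : nat) (hd : 3 <= d) : firefighter_number square_grid d 2.
Proof.
  intros u. split.
  - exists (spiral_strategy u). split; [| exists 24; apply spiral_contained_at].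
    destruct (spiral_legal u) as [H0 H]. split; [exact H0 |].
    intros t i. destruct (H t i) as [H1 H2]. split; [exact H1 |].
    now apply dist_le_weaken with 3.
  - intros j [p [_ [t Hc]]]. destruct (Nat.lt_ge_cases j 2) as [Hj | Hj].
    + destruct (not_contained_at j u p t Hj Hc).
    + exact Hj.
Qed.
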